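(* As formal power series in $q$, $$\sum_{n=1}^{\infty}K_{\geq}(n)q^n=\sum_{n=1}^{\infty}\frac{q^n\left(1-(q^{n};q)_{n-1}\right)}{(q;q)_n}.$$
   Context: For a partition $\pi$ of a positive integer $n$, the Kimberling index is $K(\pi)=(\text{largest part of }\pi)-(\text{least part of }\pi)-(\text{number of parts of }\pi)$. $K_{\geq}(n)$ is the number of partitions $\pi$ of $n$ with $K(\pi)\ge 0$. Notation: $(\alpha;q)_0=1$ and $(\alpha;q)_n=\prod_{j=0}^{n-1}(1-\alpha q^j)$ for $n\ge 1$. *)

(* Defs.v *)
From HB Require Import structures.
From mathcomp Require Import all_boot all_order all_algebra.
From mathcomp Require Import boolp.

Set Implicit Arguments.
Unset Strict Implicit.
Unset Printing Implicit Defensive.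

Import GRing.Theory.
Local Open Scope ring_scope.

(* Partitions are nonincreasing sequences of positive integers. *)
Definition is_partition (n : nat) (s : seq nat) : bool :=
  [&& sorted geq s, 0%N \notin s & sumn s == n].

(* By monotonicity of s, its head is its largest part and its last item is its
   least part. *)
Definition kimberling (s : seq nat) : int :=
  (head 0%N s)%:Z - (last 0%N s)%:Z - (size s)%:Z.

(* A partition of n has at most n parts, all of them at most n, so all the
   partitions of n live in the finite type n.-bseq 'I_n.+1; see
   is_partition_bseq. *)
Definition K_ge (n : nat) : nat :=
  #|[set s : n.-bseq 'I_n.+1 |
       is_partition n (map val s) && (0 <= kimberling (map val s))]|.

Lemma is_partition_bseq n s :
  is_partition n s -> exists! t : n.-bseq 'I_n.+1, map val t = s.
Proof.
case/and3P=> _ s_gt0 /eqP s_n.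
have s_le x : x \in s -> (x < n.+1)%N.
  rewrite -s_n ltnS; elim: (s) => //= y r IHr; rewrite inE.
  case/predU1P=> [->|/IHr le_xr]; first exact: leq_addr.
  exact: leq_trans le_xr (leq_addl _ _).
have sz_s : (size s <= n)%N.
  rewrite -s_n; elim: (s) s_gt0 => //= y r IHr; rewrite inE negb_or.
  by case/andP; rewrite eq_sym -lt0n => y_gt0 /IHr; exact: leq_add y_gt0.
have Ds : map val (map (@inord n) s) = s.
  rewrite -map_comp -[RHS]map_id; apply/eq_in_map => x /s_le ltx /=.
  exact: inordK.
have sz_t : (size (map (@inord n) s) <= n)%N by rewrite size_map.
exists (Bseq sz_t); split=> // t Dt.
by apply/val_inj/(inj_map val_inj); rewrite /= Ds Dt.
Qed.

(* The series \sum_n (coefps f n) q^n is represented by its coefficients. *)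
Record fps (R : Type) : Type := Fps {coefps : nat -> R}.

Section FpsEq.
Variable R : Type.

Lemma fpsP (f g : fps R) : coefps f =1 coefps g -> f = g.
Proof. by case: f g => [f] [g] /= /funext ->. Qed.

HB.instance Definition _ := gen_eqMixin (fps R).
HB.instance Definition _ := gen_choiceMixin (fps R).

End FpsEq.

Section FpsZmodule.
Variable R : zmodType.
Implicit Types f g h : fps R.

Definition fps_zero : fps R := Fps (fun=> 0).
Definition fps_opp f := Fps (fun n => - coefps f n).
Definition fps_add f g := Fps (fun n => coefps f n + coefps g n).

Lemma fps_addA : associative fps_add.
Proof. by move=> f g h; apply: fpsP => n; exact: addrA. Qed.

Lemma fps_addC : commutative fps_add.
Proof. by move=> f g; apply: fpsP => n; exact: addrC. Qed.

Lemma fps_add0 : left_id fps_zero fps_add.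
Proof. by move=> f; apply: fpsP => n; exact: add0r. Qed.

Lemma fps_addN : left_inverse fps_zero fps_opp fps_add.
Proof. by move=> f; apply: fpsP => n; exact: addNr. Qed.

HB.instance Definition _ :=
  GRing.isZmodule.Build (fps R) fps_addA fps_addC fps_add0 fps_addN.

End FpsZmodule.

Section FpsRing.
Variable R : comNzRingType.
Implicit Types f g h : fps R.

Definition fps_one : fps R := Fps (fun n => (n == 0%N)%:R).
Definition fps_mul f g :=
  Fps (fun n => \sum_(i < n.+1) coefps f i * coefps g (n - i)).

Definition fps_trunc n f : {poly R} := \poly_(i < n.+1) coefps f i.

Lemma coef_fps_trunc n f i : (i <= n)%N -> (fps_trunc n f)`_i = coefps f i.
Proof. by rewrite coef_poly ltnS => ->. Qed.

Lemma coefps_mul n f g i : (i <= n)%N ->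
  coefps (fps_mul f g) i = (fps_trunc n f * fps_trunc n g)`_i.
Proof.
move=> le_in; rewrite coefM; apply: eq_bigr => j _.
rewrite !coef_fps_trunc ?(leq_trans (leq_subr _ _) le_in) //.
by rewrite (leq_trans _ le_in) // -ltnS.
Qed.

Lemma fps_mulA : associative fps_mul.
Proof.
move=> f g h; apply: fpsP => n.
transitivity (fps_trunc n f * (fps_trunc n g * fps_trunc n h))`_n.
  rewrite coefM; apply: eq_bigr => i _.
  by rewrite (@coefps_mul n) ?leq_subr // coef_fps_trunc // -ltnS.
rewrite mulrA coefM; apply: eq_bigr => i _.
by rewrite (@coefps_mul n) -1?ltnS // coef_fps_trunc ?leq_subr.
Qed.

Lemma fps_mulC : commutative fps_mul.
Proof. by move=> f g; apply: fpsP => n; rewrite !(@coefps_mul n) // mulrC. Qed.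

Lemma fps_mul1 : left_id fps_one fps_mul.
Proof.
move=> f; apply: fpsP => n.
rewrite /= big_ord_recl /= mul1r subn0 big1 ?addr0 // => i _.
by rewrite /= mul0r.
Qed.

Lemma fps_mulDl : left_distributive fps_mul (@fps_add R).
Proof.
move=> f g h; apply: fpsP => n; rewrite /= -big_split /=.
by apply: eq_bigr => i _; rewrite mulrDl.
Qed.

Lemma fps_one_neq0 : fps_one != 0 :> fps R.
Proof.
apply/eqP => /(congr1 (fun f => coefps f 0)) /= /eqP.
by rewrite oner_eq0.
Qed.

HB.instance Definition _ := GRing.Zmodule_isComNzRing.Build (fps R)
  fps_mulA fps_mulC fps_mul1 fps_mulDl fps_one_neq0.

Definition fpsX : fps R := Fps (fun n => (n == 1%N)%:R).

End FpsRing.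

Section FpsUnitRing.
Variable R : comUnitRingType.
Implicit Types f g : fps R.

Definition fps_unit : pred (fps R) := [pred f | coefps f 0 \is a GRing.unit].

(* The first n coefficients of the inverse g of f, obtained by solving
   \sum_(i < m.+1) g_i f_(m - i) = (m == 0) for g_m. *)
Fixpoint fps_inv_seq f (n : nat) : seq R :=
  if n is m.+1 then
    let s := fps_inv_seq f m in
    rcons s ((coefps f 0)^-1 *
             ((m == 0%N)%:R - \sum_(i < m) s`_i * coefps f (m - i)))
  else [::].

(* As for every unit ring, the inverse of a nonunit is itself. *)
Definition fps_inv f : fps R :=
  if f \in fps_unit then Fps (fun n => (fps_inv_seq f n.+1)`_n) else f.

Lemma size_fps_inv_seq f n : size (fps_inv_seq f n) = n.
Proof. by elim: n => //= n IHn; rewrite size_rcons IHn. Qed.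

Lemma nth_fps_inv_seq f n i : (i < n)%N ->
  (fps_inv_seq f n)`_i = (fps_inv_seq f i.+1)`_i.
Proof.
elim: n => // n IHn; rewrite ltnS leq_eqVlt => /predU1P[-> // | lt_in].
by rewrite [in LHS]/= nth_rcons size_fps_inv_seq lt_in IHn.
Qed.

Lemma fps_mulVx : {in fps_unit, left_inverse 1 fps_inv *%R}.
Proof.
move=> f Uf; apply: fpsP => n; rewrite /fps_inv Uf.
rewrite [LHS]/= big_ord_recr /= subnn.
rewrite nth_rcons size_fps_inv_seq ltnn eqxx mulrC mulVKr //.
rewrite addrC -[RHS](subrK (\sum_(i < n) (fps_inv_seq f n)`_i *
                              coefps f (n - i))).
by congr (_ + _); apply: eq_bigr => i _; rewrite [in RHS]nth_fps_inv_seq.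
Qed.

Lemma fps_unitPl f g : g * f = 1 -> f \in fps_unit.
Proof.
move/(congr1 (fun h => coefps h 0)); rewrite /= big_ord1 /= => gf1.
by rewrite inE; apply/unitrPr; exists (coefps g 0); rewrite mulrC.
Qed.

Lemma fps_inv_out : {in [predC fps_unit], fps_inv =1 id}.
Proof. by move=> f /negbTE nUf; rewrite /fps_inv nUf. Qed.

HB.instance Definition _ := GRing.ComNzRing_hasMulInverse.Build (fps R)
  fps_mulVx fps_unitPl fps_inv_out.

Lemma fps_unitE f :
  (f \is a GRing.unit) = (coefps f 0 \is a GRing.unit).
Proof. by []. Qed.

End FpsUnitRing.

(* \sum_(n >= m) F n = S coefficientwise: every coefficient of the partial sums
   is eventually equal to that of S. *)
Definition fps_sums_to (R : zmodType) (m : nat) (F : nat -> fps R)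
    (S : fps R) : Prop :=
  forall k, exists N, forall n, (N <= n)%N ->
    coefps (\sum_(m <= i < n) F i) k = coefps S k.

Lemma fps_sums_to_uniq (R : zmodType) m (F : nat -> fps R) S T :
  fps_sums_to m F S -> fps_sums_to m F T -> S = T.
Proof.
move=> FS FT; apply: fpsP => k; have [N HN] := FS k; have [M HM] := FT k.
by rewrite -(HN (maxn N M)) ?leq_maxl // HM ?leq_maxr.
Qed.

(* (a; q)_n *)
Definition qpoch (A : comNzRingType) (a q : A) (n : nat) : A :=
  \prod_(j < n) (1 - a * q ^+ j).

Lemma qpoch_unit (R : comUnitRingType) n :
  qpoch (fpsX R) (fpsX R) n \is a GRing.unit.
Proof.
rewrite /qpoch; elim/big_rec: _ => [|j f _ Uf]; first exact: unitr1.
rewrite unitrM Uf andbT.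
rewrite fps_unitE [coefps _ _]/= big_ord1 /= mul0r subr0.
exact: unitr1.
Qed.

(* Main.v *)
Require Import Defs.
From HB Require Import structures.
From mathcomp Require Import all_boot all_order all_algebra.
From mathcomp Require Import zify ring.

Set Implicit Arguments.
Unset Strict Implicit.
Unset Printing Implicit Defensive.

Import GRing.Theory.
Local Open Scope ring_scope.

(** A partition with [m.+1] parts and least part [l] is obtained by adding [l]
   to every entry of [rcons t 0], where [t] is a nonincreasing sequence of
   length [m]; its Kimberling index is nonnegative iff the head of [t] exceeds
   [m].  Nonincreasing sequences of length [m] with entries at most [a] have
   generating function the Gaussian binomial [(q^(a+1); q)_m / (q; q)_m], which
   tends to [1 / (q; q)_m] as [a] grows.  Hence the partitions with [m.+1]
   parts contribute
   [(\sum_(l >= 1) q^(l(m+1))) (1 - (q^(m+1); q)_m) / (q; q)_m], the term of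
   index [m.+1] of the right-hand side. *)

(** * Bounded nonincreasing sequences and Gaussian binomials *)

(** Split on whether the first entry attains the bound [a]: the inner fixpoint then shortens the
    sequence, the outer one lowers the bound. This is the Pascal recurrence for Gaussian
    binomials. *)
Fixpoint box (a : nat) : nat -> seq (seq nat) :=
  fix box_a m := if m is m'.+1
    then [seq a :: t | t <- box_a m'] ++ (if a is a'.+1 then box a' m else [::])
    else [:: [::]].

Lemma box0 a : box a 0 = [:: [::]].
Proof. by case: a. Qed.

Lemma box0S m : box 0 m.+1 = [seq 0%N :: t | t <- box 0 m].
Proof. by rewrite /= cats0. Qed.

Lemma boxSS a m :
  box a.+1 m.+1 = [seq a.+1 :: t | t <- box a.+1 m] ++ box a m.+1.
Proof. by []. Qed.

Lemma path_geq_head a s : path geq a s = (head 0%N s <= a)%N && sorted geq s.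
Proof. by case: s. Qed.

Lemma mem_cons_map (a : nat) (S : seq (seq nat)) x s :
  (x :: s \in [seq a :: t | t <- S]) = (x == a) && (s \in S).
Proof.
apply/mapP/andP => [[t tS [-> ->]] | [/eqP -> sS]]; first by rewrite eqxx.
by exists s.
Qed.

Lemma mem_box a m s :
  (s \in box a m) = [&& size s == m, sorted geq s & (head 0%N s <= a)%N].
Proof.
elim: a m s => [|a IHa] m s; elim: m s => [|m IHm] [|x s]; rewrite ?box0 //.
- by rewrite box0S; apply/mapP => -[].
- rewrite box0S mem_cons_map IHm /= path_geq_head eqSS !leqn0.
  case: eqP => [->|_]; rewrite ?andbF //= andbT leqn0.
  by congr (_ && _); exact: andbC.
- by rewrite boxSS mem_cat IHa orbF; apply/mapP => -[].
rewrite boxSS mem_cat mem_cons_map IHm IHa /= path_geq_head eqSS.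
rewrite [(x <= a.+1)%N]leq_eqVlt ltnS; case: eqP => [->|_] /=.
  rewrite ltnn !andbF orbF andbT; congr (_ && _); exact: andbC.
by [].
Qed.

Lemma box_uniq a m : uniq (box a m).
Proof.
have cons_inj x : injective (cons x : seq nat -> seq nat) by move=> s t [].
elim: a m => [|a IHa] m; elim: m => [|m IHm] //.
  by rewrite box0S map_inj_uniq.
rewrite boxSS cat_uniq map_inj_uniq // IHm IHa andbT /=.
apply/hasPn => -[|x s]; first by rewrite mem_box.
rewrite mem_cons_map mem_box => /and3P[_ _ /= le_xa].
by rewrite negb_and neq_ltn ltnS le_xa.
Qed.

Lemma qpoch_recl (A : comNzRingType) (a q : A) n :
  qpoch a q n.+1 = (1 - a) * qpoch (a * q) q n.
Proof.
rewrite /qpoch big_ord_recl expr0 mulr1; congr (_ * _).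
by apply: eq_bigr => i _; rewrite lift0 exprS mulrA.
Qed.

Lemma qpoch_recr (A : comNzRingType) (a q : A) n :
  qpoch a q n.+1 = qpoch a q n * (1 - a * q ^+ n).
Proof. by rewrite /qpoch big_ord_recr. Qed.

(** Denominators are cleared, so any commutative ring will do. In the inductive step both parts of
    [boxSS] share the factor [(q^(a+2); q)_m], with cofactors [q^(a+1) (1 - q^(m+1))] and
    [1 - q^(a+1)], which add up to [1 - q^(a+m+2)]. *)
Lemma sum_box (A : comNzRingType) (q : A) a m :
  (\sum_(t <- box a m) q ^+ sumn t) * qpoch q q m = qpoch (q ^+ a.+1) q m.
Proof.
have cons_sum x S : \sum_(t <- [seq x :: t | t <- S]) q ^+ sumn t
    = q ^+ x * \sum_(t <- S) q ^+ sumn t.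
  by rewrite big_map mulr_sumr; apply: eq_bigr => t _; rewrite /= exprD.
elim: a m => [|a IHa] m; elim: m => [|m IHm].
- by rewrite big_seq1 expr0 mul1r /qpoch !big_ord0.
- by rewrite box0S cons_sum mul1r qpoch_recr mulrA IHm expr1 -qpoch_recr.
- by rewrite big_seq1 expr0 mul1r /qpoch !big_ord0.
rewrite boxSS big_cat cons_sum /= mulrDl IHa.
rewrite (qpoch_recr q) (qpoch_recl (q ^+ a.+1)) -exprSr.
rewrite mulrACA [_ * qpoch q q m]mulrC.
rewrite -mulrA [X in X + _](_ : _ =
  (\sum_(t <- box a.+1 m) q ^+ sumn t) * qpoch q q m * (q ^+ a.+1 * (1 - q * q ^+ m))); last by ring.
by rewrite IHm qpoch_recr !exprS; ring.
Qed.

Lemma box_filter a m : (m <= a)%N ->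
  perm_eq [seq t <- box a m | (head 0%N t <= m)%N] (box m m).
Proof.
move=> le_ma; apply: uniq_perm; rewrite ?filter_uniq ?box_uniq // => t.
rewrite mem_filter !mem_box andbC -!andbA; do 2!congr (_ && _).
by apply/andP/idP => [[] //|le_tm]; rewrite (leq_trans le_tm).
Qed.

(** Complementary counting: by [box_filter], the sequences with head at most [m] are those of
    [box m m]. *)
Lemma sum_box_gt (A : comNzRingType) (q : A) a m : (m <= a)%N ->
  (\sum_(t <- box a m | (m < head 0%N t)%N) q ^+ sumn t) * qpoch q q m
  = qpoch (q ^+ a.+1) q m - qpoch (q ^+ m.+1) q m.
Proof.
move=> le_ma; rewrite -!sum_box -mulrBl; congr (_ * _).
rewrite -[in RHS](perm_big _ (box_filter le_ma)) big_filter /=.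
rewrite [X in _ = X - _](bigID (fun t => (head 0%N t <= m)%N)) /=.
rewrite [X in _ = X - _]addrC addrK.
by apply: eq_bigl => t; rewrite ltnNge.
Qed.

(** * Partitions as shifted sequences *)

(* The least part is [p.2.+1], so that [p.2] can range over [iota 0 k]. *)
Definition part_of (p : nat * nat) (t : seq nat) : seq nat :=
  map (addn p.2.+1) (rcons t 0%N).

Lemma size_part_of p t : size (part_of p t) = (size t).+1.
Proof. by rewrite size_map size_rcons. Qed.

Lemma last_part_of x p t : last x (part_of p t) = p.2.+1.
Proof. by rewrite /part_of map_rcons last_rcons addn0. Qed.

Lemma sumn_part_of p t :
  sumn (part_of p t) = (p.2.+1 * (size t).+1 + sumn t)%N.
Proof.
rewrite /part_of map_rcons sumn_rcons.
elim: t => [|x t IHt] /=; first by rewrite muln1 addn0.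
by rewrite -addnA IHt; lia.
Qed.

Lemma kimberling_part_of p t :
  (0 <= kimberling (part_of p t)) = (size t < head 0%N t)%N.
Proof.
rewrite /kimberling last_part_of size_part_of.
(* For empty [t] the index is -1, in agreement with the default head 0. *)
by case: t => [|x t] /=; lia.
Qed.

Lemma sorted_rcons_geq (s : seq nat) x :
  sorted geq (rcons s x) = all (leq x) s && sorted geq s.
Proof.
have geq_trans : transitive geq by move=> b a c /= ba cb; exact: leq_trans cb ba.
rewrite !sorted_pairwise // pairwise_rcons; congr (_ && _).
Qed.

Lemma is_partition_part_of n p t : sorted geq t ->
  is_partition n (part_of p t) = (sumn (part_of p t) == n).
Proof.
move=> st; rewrite /is_partition; set b := _ == n.
suff [-> ->] : sorted geq (part_of p t) /\ 0%N \notin part_of p t by [].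
split; last by apply/mapP => -[y _]; lia.
rewrite sorted_map (@eq_sorted _ _ geq) => [|x y /=]; last by rewrite leq_add2l.
by rewrite sorted_rcons_geq st andbT; apply/allP.
Qed.

(** A finite list large enough to contain every partition of [k]; it also holds partitions of other
    integers, which [K_ge_count] filters out. *)
Definition part_list (k : nat) : seq (seq nat) :=
  [seq part_of p t | p <- [seq (m, l) | m <- iota 0 k, l <- iota 0 k],
                     t <- box k p.1].

(** The last entry recovers the shift, undoing the shift recovers [t], and the length of [t] is the
    first component. *)
Lemma part_of_inj p1 p2 t1 t2 : size t1 = p1.1 -> size t2 = p2.1 ->
  part_of p1 t1 = part_of p2 t2 -> p1 = p2 /\ t1 = t2.
Proof.
case: p1 p2 => [m1 l1] [m2 l2] /= s1 s2 E.
have [El] : l1.+1 = l2.+1.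
  by have := congr1 (last 0%N) E; rewrite !last_part_of.
move: E; rewrite /part_of El => /(inj_map (@addnI _)).
by move=> /rcons_inj[Et]; rewrite -s1 -s2 Et.
Qed.

Lemma part_list_uniq k : uniq (part_list k).
Proof.
apply: allpairs_uniq_dep.
- by apply: allpairs_uniq; rewrite ?iota_uniq // => -[? ?] [? ?].
- by move=> p _; exact: box_uniq.
move=> _ _ /allpairsPdep[p1 [t1 [_ + ->]]] /allpairsPdep[p2 [t2 [_ + ->]]] /=.
rewrite !mem_box => /andP[/eqP s1 _] /andP[/eqP s2 _].
by case/(part_of_inj s1 s2) => -> ->.
Qed.

Lemma leq_sumn x (s : seq nat) : x \in s -> (x <= sumn s)%N.
Proof.
elim: s => //= y s IHs; rewrite inE => /predU1P[->|/IHs]; first exact: leq_addr.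
by move/leq_trans; apply; exact: leq_addl.
Qed.

Lemma mem_part_list k s : (0 < k)%N -> is_partition k s -> s \in part_list k.
Proof.
move=> k_gt0 /and3P[+ + /eqP Ek].
case/lastP: s Ek => [|r x] Ek; first by rewrite -Ek in k_gt0.
rewrite sorted_rcons_geq mem_rcons inE negb_or eq_sym -lt0n.
case/andP=> /allP le_xr sr /andP[x_gt0 _].
pose t := [seq (y - x)%N | y <- r].
have Es : rcons r x = part_of (size r, x.-1) t.
  rewrite /part_of map_rcons prednK // addn0; congr rcons.
  rewrite -map_comp -[LHS]map_id; apply/eq_in_map => y /le_xr /= le_xy.
  by rewrite subnKC.
have sz : size t = size r by rewrite size_map.
have Ek' : k = (x * (size r).+1 + sumn t)%N.
  by rewrite -Ek Es sumn_part_of sz prednK.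
rewrite Es; apply/allpairsPdep; exists (size r, x.-1), t; split=> //.
  (* Both bounds follow from [Ek'], since [x] is positive. *)
  by apply/allpairsP; exists (size r, x.-1); rewrite !mem_iota /=; split=> //; nia.
rewrite mem_box sz eqxx /=; apply/andP; split.
  by apply: homo_sorted sr => y z /=; lia.
rewrite Ek' (@leq_trans (sumn t)) ?leq_addl //.
by case: (t) => //= y u; exact: leq_addr.
Qed.

(** Both sides count the same duplicate-free family; [is_partition_bseq] lifts a listed partition
    back to the finite type. *)
Lemma K_ge_count k : (0 < k)%N -> K_ge k =
  count (fun s => is_partition k s && (0 <= kimberling s)) (part_list k).
Proof.
move=> k_gt0; rewrite /K_ge -size_filter; set P := fun s : seq nat => _.
rewrite cardE -(size_map (fun s : k.-bseq 'I_k.+1 => map val s)).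
apply/perm_size/uniq_perm.
- rewrite map_inj_uniq ?enum_uniq // => s t /(inj_map val_inj); exact: val_inj.
- exact/filter_uniq/part_list_uniq.
move=> s; rewrite mem_filter; apply/mapP/andP => [[t + ->]|[Ps _]].
  rewrite mem_enum inE => Pt; split=> //.
  by apply: mem_part_list => //; case/andP: Pt.
have [t [Et _]] := is_partition_bseq (proj1 (andP Ps)).
by exists t; rewrite ?mem_enum ?inE Et.
Qed.

(** * Coefficient extraction for power series *)

Section Coefficients.
Variable R : comNzRingType.
Implicit Types f g : fps R.
Local Notation q := (fpsX R).

Lemma coefpsD f g k : coefps (f + g) k = coefps f k + coefps g k.
Proof. by []. Qed.

Lemma coefpsMn f n k : coefps (f *+ n) k = coefps f k *+ n.
Proof. by elim: n => // n IHn; rewrite !mulrS coefpsD IHn. Qed.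

Lemma coefps_sum I (r : seq I) (P : pred I) (F : I -> fps R) k :
  coefps (\sum_(i <- r | P i) F i) k = \sum_(i <- r | P i) coefps (F i) k.
Proof. by apply: (big_morph (fun f => coefps f k)). Qed.

Lemma coefps_XM f k : coefps (q * f) k = if k is k'.+1 then coefps f k' else 0.
Proof.
case: k => [|k]; rewrite /= ?big_ord1 /= ?mul0r //.
rewrite big_ord_recl mul0r add0r big_ord_recl mul1r big1 ?addr0 => [|i _].
  by rewrite /bump /= subSS subn0.
by rewrite /= mul0r.
Qed.

Lemma coefps_XnM n f k :
  coefps (q ^+ n * f) k = if (n <= k)%N then coefps f (k - n) else 0.
Proof.
elim: n k => [|n IHn] k; first by rewrite mul1r subn0.
by rewrite exprS -mulrA coefps_XM; case: k => // k; rewrite IHn.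
Qed.

Lemma coefps_Xn n k : coefps (q ^+ n) k = (k == n)%:R.
Proof.
rewrite -[q ^+ n]mulr1 coefps_XnM /= subn_eq0 eqn_leq.
by case: (n <= k)%N; rewrite ?andbT ?andbF.
Qed.

(** The limit of the Gaussian numerator in finite form: with [n = k.+1] it is 1 up to terms
    invisible in degree [k]. *)
Lemma qpoch_XnE n m : exists f, qpoch (q ^+ n) q m = 1 + q ^+ n * f.
Proof.
elim: m => [|m [f Ef]]; first by exists 0; rewrite /qpoch big_ord0 mulr0 addr0.
by rewrite qpoch_recr Ef; exists (f - q ^+ m * (1 + q ^+ n * f)); ring.
Qed.

End Coefficients.

(** * Comparison of the two series in a fixed degree *)

Lemma K_ge_coefps k : (0 < k)%N -> (K_ge k)%:R = coefps
  (\sum_(0 <= m < k) \sum_(0 <= l < k)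
     fpsX int ^+ (m.+1 * l.+1) *
     \sum_(t <- box k m | (m < head 0%N t)%N) fpsX int ^+ sumn t) k.
Proof.
move=> k_gt0; rewrite K_ge_count // -sum1_count natr_sum.
rewrite /part_list big_mkcond big_allpairs_dep big_allpairs_dep /=.
rewrite coefps_sum /index_iota subn0; apply: eq_bigr => m _.
rewrite coefps_sum; apply: eq_bigr => l _.
rewrite mulr_sumr coefps_sum [RHS]big_mkcond [LHS]big_seq [RHS]big_seq.
apply: eq_bigr => t; rewrite mem_box => /and3P[/eqP st so _].
rewrite is_partition_part_of // kimberling_part_of sumn_part_of st.
rewrite -exprD coefps_Xn /= mulnC eq_sym.
by case: (m < _)%N; rewrite ?andbF ?andbT //; case: (k == _).
Qed.

Lemma sum_powers (A : comNzRingType) (x : A) k :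
  (1 - x) * \sum_(0 <= l < k) x ^+ l.+1 = x * (1 - x ^+ k).
Proof.
elim: k => [|k IHk]; first by rewrite big_geq // mulr0 subrr mulr0.
by rewrite big_nat_recr //= mulrDr IHk exprS; ring.
Qed.

(** Bounding the least part and the entries by [k] costs only multiples of [q^(k+1)], which do not
    reach degree [k]. *)
Lemma coefps_term k m : (m < k)%N -> let q := fpsX int in
  coefps (\sum_(0 <= l < k) q ^+ (m.+1 * l.+1) *
     \sum_(t <- box k m | (m < head 0%N t)%N) q ^+ sumn t) k
  = coefps (q ^+ m.+1 * (1 - qpoch (q ^+ m.+1) q m) / qpoch q q m.+1) k.
Proof.
move=> lt_mk q; have Uq := qpoch_unit int m.+1; rewrite -/q in Uq.
rewrite -mulr_suml.
under eq_bigr do rewrite exprM.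
set H := _ * _; set T := _ / _.
(* Dividing by the unit [(q; q)_(m+1)] preserves a congruence modulo [q^(k+1)]. *)
suff [f Ef] : exists f, H * qpoch q q m.+1 = T * qpoch q q m.+1 + q ^+ k.+1 * f.
  rewrite -[H](mulrK Uq) Ef mulrDl mulrK // -mulrA.
  by rewrite coefpsD coefps_XnM ltnn addr0.
rewrite mulrVK // qpoch_recr -exprS.
have -> : H * (qpoch q q m * (1 - q ^+ m.+1)) =
    ((1 - q ^+ m.+1) * \sum_(0 <= l < k) (q ^+ m.+1) ^+ l.+1) *
    ((\sum_(t <- box k m | (m < head 0%N t)%N) q ^+ sumn t) * qpoch q q m).
  by rewrite /H; ring.
rewrite sum_powers sum_box_gt; last exact: ltnW.
have [g ->] := qpoch_XnE int k.+1 m.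
set c := qpoch _ _ _; rewrite -/q.
(* The tail of the geometric sum has exponent [(m+1)(k+1) = (k+1) + m(k+1)]. *)
have -> : q ^+ m.+1 * (1 - (q ^+ m.+1) ^+ k) =
          q ^+ m.+1 - q ^+ k.+1 * q ^+ (m * k.+1).
  by rewrite mulrBr mulr1 -exprS -exprM mulSn exprD.
(* Expand the product and collect all but [q^(m+1) (1 - c)], taking out [q^(k+1)]. *)
exists (q ^+ m.+1 * g - q ^+ (m * k.+1) * (1 + q ^+ k.+1 * g - c)).
by ring.
Qed.

Theorem mainTheorem2 :
  let q : fps int := fpsX int in
  exists S : fps int,
    fps_sums_to 1 (fun n => (K_ge n)%:R * q ^+ n) S /\
    fps_sums_to 1
      (fun n => q ^+ n * (1 - qpoch (q ^+ n) q n.-1) / qpoch q q n) S.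
Proof.
(* The sums start at 1, whereas [K_ge 0 = 1] counts the empty partition. *)
move=> q; exists (Fps (fun k => if k is 0%N then 0 else (K_ge k)%:R)).
(* If each term [F i] has order at least [i], coefficient [k] of the partial sums is stationary once
   [n] exceeds [k], and only the indices 1 to [k] contribute. *)
have cut (F : nat -> fps int) k n : (k < n)%N ->
    (forall i, (k < i)%N -> coefps (F i) k = 0) ->
    coefps (\sum_(1 <= i < n) F i) k = \sum_(0 <= i < k) coefps (F i.+1) k.
  move=> lt_kn F0; rewrite coefps_sum (@big_cat_nat _ _ _ k.+1) //=.
  rewrite [X in _ + X]big_nat_cond [X in _ + X]big1 ?addr0 => [|i].
    by rewrite big_add1.
  by case/andP=> /andP[/F0].
split=> k; exists k.+1 => n lt_kn; rewrite cut //.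
- case: k {lt_kn} => [|k]; first by rewrite big_geq.
  have coef_term i : coefps ((K_ge i.+1)%:R * q ^+ i.+1) k.+1
                     = if i == k then (K_ge k.+1)%:R else 0.
    rewrite mulr_natl coefpsMn coefps_Xn eqSS eq_sym.
    by case: eqP => [->|_] //; rewrite mul0rn.
  under eq_bigr do rewrite coef_term.
  by rewrite -big_mkcond big_nat1_eq ltnSn.
- by move=> i lt_ki; rewrite mulrC coefps_XnM leqNgt lt_ki.
- case: k {lt_kn} => [|k]; first by rewrite big_geq.
  (* The term of index [m.+1] is matched with the partitions into [m.+1] parts; [big_nat] keeps the
     bound on [m] that [coefps_term] requires. *)
  rewrite [RHS]/= K_ge_coefps // coefps_sum big_nat [RHS]big_nat.
  by apply: eq_bigr => m /andP[_ lt_mk]; rewrite -coefps_term.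
by move=> i lt_ki; rewrite -mulrA coefps_XnM leqNgt lt_ki.
Qed.
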